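(* Let $R$ be a commutative ring with identity and let $M$ be a Noetherian $R$-module. If $N$ is a 2-irreducible submodule of $M$, then either $N$ is an irreducible submodule of $M$ or $N$ is an intersection of exactly two irreducible submodules of $M$.
   Context: A proper submodule $N$ of $M$ is irreducible if $N=H_1\cap H_2$ for submodules $H_1,H_2$ of $M$ implies $N=H_1$ or $N=H_2$. A submodule $N$ of $M$ is 2-irreducible if whenever $N=H_1\cap H_2\cap H_3$ for submodules $H_1,H_2,H_3$ of $M$, then $N=H_1\cap H_2$ or $N=H_2\cap H_3$ or $N=H_1\cap H_3$.
   Formalization: N is assumed to be a proper submodule; for N = M the claim fails, since M is 2-irreducible under the given definition but is neither irreducible (irreducible submodules are proper) nor an intersection of two irreducible submodules. *)

(* Defs.v *)
From mathcomp Require Import all_boot all_order all_algebra.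
From mathcomp Require Import boolp classical_sets.

Set Implicit Arguments.
Unset Strict Implicit.
Unset Printing Implicit Defensive.

Import GRing.Theory.
Local Open Scope classical_set_scope.

(* Subsets are classical sets rather than boolean predicates, so that
   submodules are not restricted to decidable ones and equality of submodules
   is Leibniz equality. *)
Definition submodule (R : comPzRingType) (M : lmodType R) (N : set M) : Prop :=
  GRing.submod_closed [in N].

Definition noetherian_module (R : comPzRingType) (M : lmodType R) : Prop :=
  forall F : nat -> set M,
    (forall n, submodule (F n)) ->
    (forall n, F n `<=` F n.+1) ->
    exists n, forall m, (n <= m)%N -> F m = F n.

Definition irreducible_submodule (R : comPzRingType) (M : lmodType R)
    (N : set M) : Prop :=
  [/\ submodule N,
      N <> setT
    & forall H1 H2 : set M, submodule H1 -> submodule H2 ->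
        N = H1 `&` H2 -> N = H1 \/ N = H2].

(* Properness is not part of this notion: setT satisfies it. *)
Definition two_irreducible_submodule (R : comPzRingType) (M : lmodType R)
    (N : set M) : Prop :=
  submodule N /\
  forall H1 H2 H3 : set M, submodule H1 -> submodule H2 -> submodule H3 ->
    N = H1 `&` H2 `&` H3 ->
    [\/ N = H1 `&` H2, N = H2 `&` H3 | N = H1 `&` H3].

(* Main.v *)
Require Import Defs.
From mathcomp Require Import all_boot all_order all_algebra.
From mathcomp Require Import boolp classical_sets.
Local Open Scope classical_set_scope.

(** If [N] is not irreducible, write [N = H `&` K] with [H] and [K] different
    from [N], and enlarge [H] to a submodule [A] maximal for [N = A `&` K].
    Then [A] is irreducible: if [A = H1 `&` H2], then [N = H1 `&` H2 `&` K],
    and 2-irreducibility gives [N = A], which is excluded, or [N = Hi `&` K]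
    for some [i], whence [Hi = A] by maximality. Enlarging [K] in the same way
    turns [N] into an intersection of two irreducible submodules. *)

(** Otherwise every member of [P] above [H] lies strictly inside another one, and by choice these
    extensions iterate from [H] to a chain that never stabilizes. *)
Lemma noetherian_maximal (R : comPzRingType) (M : lmodType R)
    (P : set (set M)) (H : set M) :
    noetherian_module M -> (forall A, P A -> submodule A) -> P H ->
  exists A, [/\ P A, H `<=` A & forall B, P B -> A `<=` B -> B = A].
Proof.
move=> noethM Psub PH; apply: contrapT => no_max.
have /choice[f fP] : forall A, exists B,
    P A /\ H `<=` A -> [/\ P B, A `<=` B & B <> A].
  move=> A; apply: contrapT => /forallNP noB; apply: no_max; exists A.
  (* If [A] failed the premise, the implication would hold vacuously and any [B] would do, here
     [set0]. *)
  have [PA HA] : P A /\ H `<=` A by apply: contrapT => nPA; apply: (noB set0).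
  split=> // B PB AB; apply: contrapT => BA.
  by apply: (noB B).
pose F n := iter n f H.
have FP n : P (F n) /\ H `<=` F n.
  elim: n => [|n IHn]; first by split.
  have [PF FF _] := fP _ IHn.
  by split=> //; apply: subset_trans FF; case: IHn.
have [n|n|n /(_ n.+1 (leqnSn n))] := noethM F.
- by apply: Psub; case: (FP n).
- by case: (fP _ (FP n)).
- by case: (fP _ (FP n)).
Qed.

Lemma two_irreducible_enlarge (R : comPzRingType) (M : lmodType R)
    (N H K : set M) :
    noetherian_module M -> two_irreducible_submodule N ->
    submodule H -> submodule K -> N = H `&` K -> N <> H -> N <> K ->
  exists A, [/\ irreducible_submodule A, N <> A & N = A `&` K].
Proof.
move=> noethM [_ N2irr] subH subK NHK NH NK.
have [||A [[subA NAK] HA Amax]] :=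
  @noetherian_maximal R M [set A | submodule A /\ N = A `&` K] H noethM.
- by move=> A [].
- by [].
have NA : N <> A.
  move=> NA; apply: NH; apply/seteqP; split; last by rewrite NA.
  by rewrite NHK; apply: subIsetl.
exists A; split=> //; split=> //.
  (* [A] is proper, since [A = setT] would give [N = K]. *)
  by move=> AT; apply: NK; rewrite NAK AT setTI.
move=> H1 H2 subH1 subH2 AH.
have [|NH12|NH2K|NH1K] := N2irr _ _ _ subH1 subH2 subK.
- by rewrite -AH.
- by case: NA; rewrite AH.
- by right; rewrite (Amax H2) // AH; apply: subIsetr.
- by left; rewrite (Amax H1) // AH; apply: subIsetl.
Qed.

Theorem theorem2p2 (R : comPzRingType) (M : lmodType R)
    (M_noetherian : noetherian_module M)
    (N : set M) (N_proper : N <> setT)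
    (N_two_irr : two_irreducible_submodule N) :
  irreducible_submodule N \/
  exists A B : set M,
    [/\ irreducible_submodule A, irreducible_submodule B, A <> B
      & N = A `&` B].
Proof.
have [|Nred] := EM (irreducible_submodule N); [by left | right].
have [H [K [subH subK NHK NH NK]]] : exists H K,
    [/\ submodule H, submodule K, N = H `&` K, N <> H & N <> K].
  apply: contrapT => noHK; apply: Nred; split=> //; first by case: N_two_irr.
  move=> H K subH subK NHK; apply: contrapT => /not_orP[NH NK].
  by apply: noHK; exists H, K.
have [A [irrA NA NAK]] :=
  two_irreducible_enlarge _ _ _ _ _ M_noetherian N_two_irr subH subK NHK NH NK.
have [subA _ _] := irrA.
(* [K] is enlarged against [A] rather than [H], so that the resulting [B] still meets [A] in [N]. *)
have NKA : N = K `&` A by rewrite setIC.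
have [B [irrB NB NBA]] :=
  two_irreducible_enlarge _ _ _ _ _ M_noetherian N_two_irr subK subA NKA NK NA.
exists A, B; split=> //; last by rewrite setIC.
by move=> AB; apply: NA; rewrite NBA -AB setIid.
Qed.
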